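(* Let $X,Y$ be real topological-linear spaces, $\Omega\subseteq X$ nonempty, $f:X\to Y$. Suppose that $K\subseteq Y$ is a convex cone, and take sets $\mathcal P\subseteq Y$, $\mathcal T\subseteq K\setminus \ell(K)$ and $\mathcal R\subseteq\mathbb R$ such that $f[\mathrm{Eff}(\Omega\mid f,K)]\subseteq \mathcal P+\mathcal R\cdot\mathcal T$. Then, for any $\bar x\in\Omega$, the following assertions are equivalent: (1°) $\bar x\in \mathrm{Eff}(\Omega\mid f,K)$. (2°) There are some $a\in\mathcal P$, $k\in\mathcal T$ and $s\in\mathcal R$ so that $\{(x,s)\mid x\in\Omega,\ f(x)=f(\bar x)\}$ is the set of solutions of the problem $\mathrm{PS}(a,k)$: minimize $\lambda$ subject to $f(x)\in\lambda k+(a-K)$, $(x,\lambda)\in\Omega\times\mathbb R$. If, in addition, $K$ is closed, then (1°) and (2°) are equivalent to: (3°) There are some $a\in\mathcal P$, $k\in\mathcal T$ and $s\in\mathcal R$ so that $\varphi^G_{a-K,k}(f(\bar x))=s$ and $\{x\in\Omega\mid f(x)=f(\bar x)\}=\operatorname{argmin}_{x\in\Omega}\varphi^G_{a-K,k}(f(x))$.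
   Context: A set $K\subseteq Y$ is a cone if $0\in K=\mathbb R_+\cdot K$, where $\mathbb R_+=[0,\infty)$. $\ell(K):=K\cap(-K)$. $f[D]$ denotes the image of $D$ under $f$. $\mathrm{Eff}(\Omega\mid f,K)$ is the set of all $\bar x\in\Omega$ for which there is no $x\in\Omega$ with $f(x)\in f(\bar x)-(K\setminus\{0\})$ (efficient solutions). A solution of $\mathrm{PS}(a,k)$ is a feasible pair $(x,\lambda)$ whose $\lambda$ is minimal among all feasible pairs. For $a\in Y$ and $k\in K\setminus\ell(K)$, $\varphi^G_{a-K,k}(y):=\inf\{t\in\mathbb R\mid y\in tk+(a-K)\}\in\mathbb R\cup\{-\infty,+\infty\}$ for $y\in Y$ (Gerstewitz function; $\inf\emptyset=+\infty$). *)

(* Defs.v *)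
From mathcomp Require Import all_boot all_order all_algebra.
From mathcomp Require Import boolp classical_sets set_interval reals ereal.
From mathcomp Require Import topology tvs convex.

Set Implicit Arguments.
Unset Strict Implicit.
Unset Printing Implicit Defensive.

Import Order.TTheory GRing.Theory Num.Theory.

Local Open Scope classical_set_scope.
Local Open Scope ring_scope.

Definition setadd (R : realType) (V : lmodType R) (A B : set V) : set V :=
  [set a + b | a in A & b in B].

Definition setscale (R : realType) (V : lmodType R) (S : set R) (A : set V) :
  set V :=
  [set s *: a | s in S & a in A].

Definition cone (R : realType) (V : lmodType R) (K : set V) : Prop :=
  K 0 /\ K = setscale [set r : R | 0 <= r] K.

Definition lineality (R : realType) (V : lmodType R) (K : set V) : set V :=
  K `&` [set - y | y in K].

Definition reflect_at (R : realType) (V : lmodType R) (a : V) (K : set V) :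
  set V :=
  [set a - y | y in K].

Definition translate (R : realType) (V : lmodType R) (v : V) (A : set V) :
  set V :=
  [set v + y | y in A].

Definition Eff (R : realType) (X : Type) (Y : lmodType R)
    (Omega : set X)
    (f : X -> Y) (K : set Y) : set X :=
  [set xb | Omega xb /\
    ~ (exists x, Omega x /\ reflect_at (f xb) (K `\ 0) (f x))].

Definition PS_feasible (R : realType) (X : Type) (Y : lmodType R)
    (Omega : set X)
    (f : X -> Y) (K : set Y) (a k : Y) : set (X * R) :=
  [set p | Omega p.1 /\ translate (p.2 *: k) (reflect_at a K) (f p.1)].

Definition PS_solutions (R : realType) (X : Type) (Y : lmodType R)
    (Omega : set X)
    (f : X -> Y) (K : set Y) (a k : Y) : set (X * R) :=
  [set p | PS_feasible Omega f K a k p /\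
    forall q, PS_feasible Omega f K a k q -> p.2 <= q.2].

(* Defined for an arbitrary set A; the Gerstewitz function of a cone K at a is
   the case A = a - K.  As ereal_inf set0 = +oo, points outside every
   translate get the value +oo. *)
Definition gerstewitz (R : realType) (V : lmodType R) (A : set V) (k y : V) :
  \bar R :=
  ereal_inf [set t%:E | t in [set t : R | translate (t *: k) A y]].

Definition argmin (R : realType) (T : Type) (Omega : set T)
    (g : T -> \bar R) : set T :=
  [set x | Omega x /\ forall x', Omega x' -> (g x <= g x')%E].

(* Main.v *)
Require Import Defs.
From mathcomp Require Import all_boot all_order all_algebra.
From mathcomp Require Import boolp classical_sets set_interval reals ereal.
From mathcomp Require Import topology tvs convex.

(** If [xb] is efficient and [f xb = a + s *: k], then [(xb, s)] is feasible for
    PS(a,k).  A feasible [(x, t)] with [t <= s] gives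
    [f xb - f x = (s - t) *: k + y] with [y] in [K]; efficiency forces this
    element of [K] to vanish, hence [t = s] (as [- k] is not in [K]) and
    [f x = f xb].  Conversely, a point dominating [xb] is feasible whenever [xb]
    is, with the same [t], so that it belongs to the solution set as well.  When
    [K] is closed, the infimum defining the Gerstewitz function is attained as
    soon as it is finite. *)

Import Order.TTheory GRing.Theory Num.Theory.
Import numFieldTopology.Exports.

Local Open Scope classical_set_scope.
Local Open Scope ring_scope.

Lemma coneZ (R : realType) (V : lmodType R) (K : set V) (t : R) (y : V) :
  cone K -> 0 <= t -> K y -> K (t *: y).
Proof. by move=> [_ KE] t0 Ky; rewrite KE; exists t => //; exists y. Qed.

(** Convexity with both weights [2^-1] puts the midpoint of [x] and [y] in [K], and doubling it
    gives the sum. *)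
Lemma coneD (R : realType) (V : lmodType R) (K : set V) (x y : V) :
  cone K -> convex_set K -> K x -> K y -> K (x + y).
Proof.
move=> cK vK Kx Ky.
have h0 : 0 <= 2^-1 :> R by rewrite invr_ge0.
have h1 : 2^-1 <= 1 :> R by rewrite invf_le1 // ler1n.
have /set_mem := vK x y (Itv01 h0 h1) (mem_set Kx) (mem_set Ky).
rewrite /conv /= => Kxy.
suff -> : x + y = 2 *: (2^-1 *: x + (1 - 2^-1) *: y) by exact: coneZ.
have n2 : 2 != 0 :> R by rewrite pnatr_eq0.
by rewrite scalerDr !scalerA mulrBr divff // mulr1 [2 - 1]addrK !scale1r.
Qed.

Lemma notin_lineality (R : realType) (V : lmodType R) (K : set V) (k : V) :
  (K `\` lineality K) k -> ~ K (- k).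
Proof.
by move=> [Kk nlk] KNk; apply: nlk; split=> //; exists (- k); rewrite ?opprK.
Qed.

(** Reduces nested images to a single membership in [K], where the cone rules apply directly. *)
Lemma translate_reflectE (R : realType) (V : lmodType R) (K : set V)
    (a v z : V) :
  translate v (reflect_at a K) z <-> K (v + a - z).
Proof.
split=> [[_ [y Ky <-] <-]|Kz]; first by rewrite addrA subKr.
exists (z - v); last by rewrite subrKC.
exists (v + a - z) => //.
by rewrite opprB [v + a]addrC addrCA opprD [a + _]addrA subrr add0r.
Qed.

Lemma PS_feasibleE (R : realType) (X : Type) (Y : lmodType R) (Omega : set X)
    (f : X -> Y) (K : set Y) (a k : Y) (x : X) (t : R) :
  PS_feasible Omega f K a k (x, t) <-> Omega x /\ K (t *: k + a - f x).
Proof. by rewrite /PS_feasible /= translate_reflectE. Qed.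

(** The only candidate for the removed direction is [f xb - f x], so excluding [0] from [K] amounts
    to allowing equal values. *)
Lemma EffP (R : realType) (X : Type) (Y : lmodType R) (Omega : set X)
    (f : X -> Y) (K : set Y) (xb : X) :
  Eff Omega f K xb <->
  Omega xb /\ forall x, Omega x -> K (f xb - f x) -> f x = f xb.
Proof.
split=> -[Oxb dom]; split=> //.
  move=> x Ox Kd; apply: contrapT => neq; apply: dom; exists x; split=> //.
  exists (f xb - f x); last by rewrite subKr.
  by split=> // /eqP; rewrite subr_eq0 => /eqP /esym.
move=> [x [Ox [y [Ky y0] fx]]]; apply: y0.
have yE : y = f xb - f x by rewrite -fx subKr.
by rewrite /= yE (dom x Ox) ?subrr // -yE.
Qed.

Lemma Eff_PS_unique (R : realType) (X : Type) (Y : lmodType R) (Omega : set X)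
    (f : X -> Y) (K : set Y) (a k : Y) (s t : R) (xb x : X) :
  cone K -> convex_set K -> K k -> ~ K (- k) ->
  Eff Omega f K xb -> f xb = a + s *: k ->
  Omega x -> K (t *: k + a - f x) -> t <= s -> t = s /\ f x = f xb.
Proof.
move=> cK vK Kk KNk /EffP[_ eff] fxb Ox Kx ts.
have fx : f x = f xb.
  apply: eff => //.
  suff -> : f xb - f x = (s - t) *: k + (t *: k + a - f x).
    by apply: coneD => //; apply: coneZ => //; rewrite subr_ge0.
  by rewrite fxb scalerBl !addrA subrK [a + _]addrC.
split=> //; apply: contrapT => /eqP tNs; apply: KNk.
have st : 0 < s - t by rewrite subr_gt0 lt_neqAle tNs.
(* Since [f x = f xb = a + s *: k], the element of [K] on the right is [(t - s) *: k], a positive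
   multiple of [- k]. *)
suff -> : - k = (s - t)^-1 *: (t *: k + a - f x).
  by apply: coneZ => //; rewrite invr_ge0 ltW.
rewrite fx fxb addrKA -scalerBl -[t - s]opprB scaleNr scalerN scalerA.
by rewrite mulVf ?gt_eqF // scale1r.
Qed.

Lemma gerstewitz_le (R : realType) (V : lmodType R) (K : set V) (a k z : V)
    (t : R) :
  K (t *: k + a - z) -> (gerstewitz (reflect_at a K) k z <= t%:E)%E.
Proof.
by move=> Kt; apply: ereal_inf_lbound; exists t => //; apply/translate_reflectE.
Qed.

(** Adding [z' - z] shows that each [t] admissible for [z'] is admissible for [z], so the infimum
    for [z] runs over a larger set. *)
Lemma le_gerstewitz (R : realType) (V : lmodType R) (K : set V) (a k z z' : V) :
  cone K -> convex_set K -> K (z' - z) ->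
  (gerstewitz (reflect_at a K) k z <= gerstewitz (reflect_at a K) k z')%E.
Proof.
move=> cK vK Kz; apply: le_ereal_inf_tmp => _ [t /translate_reflectE Kt <-].
by apply: gerstewitz_le; rewrite -(subrKA z'); exact: coneD.
Qed.

Lemma gerstewitz_attained (R : realType) (Y : topologicalLmodType R)
    (K : set Y) (a k z : Y) (s : R) :
  closed K -> gerstewitz (reflect_at a K) k z = s%:E -> K (s *: k + a - z).
Proof.
move=> clK gs; apply: clK => B nB.
(* The aim is to place [s *: k + a - z] in the closure of [K], by following this line as [t]
   approaches [s]. *)
have cont : {for (s : R^o), continuous (fun t : R^o => t *: k + (a - z))}.
  apply: (@continuous_comp _ _ _ (fun t : R^o => (t *: k, a - z))
    (fun p : Y * Y => p.1 + p.2)); last exact: add_continuous.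
  apply: cvg_pair; last exact: cvg_cst.
  apply: (@continuous_comp _ (R^o * Y)%type _ (fun t : R^o => (t, k))
    (fun p => p.1 *: p.2)); last exact: scale_continuous.
  by apply: (@cvg_pair _ _ _ _ (nbhs (s : R^o))); [exact: cvg_id|exact: cvg_cst].
have /nbhs_ballP[e /= e0 sB] :
    nbhs (s : R^o) [set t : R^o | B (t *: k + (a - z))].
  by apply: cont; rewrite /= addrA.
(* As [s] is the infimum, some admissible [t] lies in [[s, s + e)]; its point on the line is both in
   [K] and in [B]. *)
have : (gerstewitz (reflect_at a K) k z < (s + e)%:E)%E.
  by rewrite gs lte_fin ltrDl.
move=> /ereal_inf_lt [_ [t /translate_reflectE Kt <-]]; rewrite lte_fin => te.
exists (t *: k + a - z); split=> //; rewrite -addrA; apply: sB.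
have st : s <= t by rewrite -lee_fin -gs; exact: gerstewitz_le.
by rewrite /ball /= distrC ger0_norm ?subr_ge0 // ltrBlDl.
Qed.

Theorem proposition9 (R : realType) (X Y : topologicalLmodType R)
    (Omega : set X) (f : X -> Y) (K P T : set Y) (S : set R)
    (Omega_neq0 : Omega !=set0)
    (K_cone : cone K) (K_convex : convex_set K)
    (T_sub : T `<=` K `\` lineality K)
    (Eff_sub : f @` Eff Omega f K `<=` setadd P (setscale S T)) :
  forall xb : X, Omega xb ->
    (Eff Omega f K xb <->
     exists a k s, [/\ P a, T k, S s &
       [set (x, s) | x in [set x | Omega x /\ f x = f xb]] =
         PS_solutions Omega f K a k])
    /\
    (closed K ->
      (Eff Omega f K xb <->
       exists a k s, [/\ P a, T k, S s,
         gerstewitz (reflect_at a K) k (f xb) = s%:E &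
         [set x | Omega x /\ f x = f xb] =
           argmin Omega (fun x => gerstewitz (reflect_at a K) k (f x))])).
Proof.
move=> xb Oxb.
have rep : Eff Omega f K xb ->
    exists a k s, [/\ P a, T k, S s & f xb = a + s *: k].
  move=> eff; have [|a Pa [_ [s Ss [k Tk <-]] fE]] := Eff_sub (f xb).
    by exists xb.
  by exists a, k, s.
have K0 : K 0 by case: K_cone.
have feas a k s x : f xb = a + s *: k -> f x = f xb -> K (s *: k + a - f x).
  by move=> fxb ->; rewrite fxb [a + _]addrC subrr.
split=> [|clK]; split.
- move=> eff; have [a [k [s [Pa Tk Ss fxb]]]] := rep eff.
  have [Kk _] := T_sub _ Tk; have KNk := notin_lineality _ _ _ _ (T_sub _ Tk).
  have uniq x t := Eff_PS_unique _ _ _ _ _ _ _ _ s t _ x K_cone K_convex Kk KNk eff fxb.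
  exists a, k, s; split=> //; apply/seteqP; split.
    move=> _ [x [Ox fx] <-]; split; first by apply/PS_feasibleE; split=> //; exact: feas.
    move=> [x' t] /PS_feasibleE[Ox' Kx'] /=; rewrite leNgt; apply/negP => ts.
    have [tE _] := uniq _ _ Ox' Kx' (ltW ts).
    by move: ts; rewrite tE ltxx.
  move=> [x t] [/PS_feasibleE[Ox Kx] tmin].
  (* Comparing with the feasible pair [(xb, s)] bounds [t], which is what uniqueness needs. *)
  have ts : t <= s.
    by apply: (tmin (xb, s)); apply/PS_feasibleE; split=> //; exact: feas.
  by have [-> fx] := uniq _ _ Ox Kx ts; exists x.
- move=> [a [k [s [_ _ _ solE]]]]; apply/EffP; split=> // x Ox Kd.
  have [/PS_feasibleE[_ Kxb] smin] : PS_solutions Omega f K a k (xb, s).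
    by rewrite -solE; exists xb.
  (* Minimality depends only on the second component, so feasibility of [(x, s)] suffices; it
     follows by adding [f xb - f x] to the slack of [xb]. *)
  have : PS_solutions Omega f K a k (x, s).
    split=> //; apply/PS_feasibleE; split=> //.
    by rewrite -(subrKA (f xb)); exact: coneD.
  by rewrite -solE => -[x' [_ fx'] [<-]].
- move=> eff; have [a [k [s [Pa Tk Ss fxb]]]] := rep eff.
  have [Kk _] := T_sub _ Tk; have KNk := notin_lineality _ _ _ _ (T_sub _ Tk).
  have uniq x t := Eff_PS_unique _ _ _ _ _ _ _ _ s t _ x K_cone K_convex Kk KNk eff fxb.
  have sle x : Omega x -> (s%:E <= gerstewitz (reflect_at a K) k (f x))%E.
    move=> Ox; apply: le_ereal_inf_tmp => _ [t /translate_reflectE Kt <-].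
    rewrite lee_fin leNgt; apply/negP => ts.
    by have [tE _] := uniq _ _ Ox Kt (ltW ts); move: ts; rewrite tE ltxx.
  have gs : gerstewitz (reflect_at a K) k (f xb) = s%:E.
    by apply/eqP; rewrite eq_le sle // gerstewitz_le //; exact: feas.
  exists a, k, s; split=> //; apply/seteqP; split=> x [Ox].
    by move=> fx; split=> // x' Ox'; rewrite fx gs; exact: sle.
  move=> gmin; split=> //.
  (* Closedness of [K] turns this value into feasibility of [(x, s)], and uniqueness then gives
     [f x = f xb]. *)
  have gx : gerstewitz (reflect_at a K) k (f x) = s%:E.
    by apply/eqP; rewrite eq_le sle // -gs gmin.
  by have [] := uniq x s Ox (gerstewitz_attained _ _ _ _ _ _ _ clK gx) (lexx s).
- move=> [a [k [s [_ _ _ _ argE]]]]; apply/EffP; split=> // x Ox Kd.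
  have [_ xbmin] : argmin Omega (fun x => gerstewitz (reflect_at a K) k (f x)) xb.
    by rewrite -argE.
  (* By monotonicity a dominating [x] has a value no larger than that of the minimizer [xb]. *)
  suff : argmin Omega (fun x => gerstewitz (reflect_at a K) k (f x)) x.
    by rewrite -argE => -[].
  split=> // x' Ox'; apply: le_trans (xbmin _ Ox'); exact: le_gerstewitz.
Qed.
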